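(* Let $M\ge3$, $2<K<\frac{M}{2}$, and let $\mathcal{S}_K$ be the collection of all subsets of $\{1,\dots,M\}$ of size exactly $K$. Consider the outlier hypothesis testing problem with $K$ (known number) possibly distinctly distributed outliers described in the context, in the setting where neither the $\mu_i$ nor $\pi$ is known. For each threshold $T$, let $(N^*,\delta^* )$ be the test with parameter $T$ described in the context, and let $P_{\max}$ be its maximal error probability. Then this test is universally exponentially consistent, and for all full-support $\mu_1,\dots,\mu_M,\pi\in\mathcal{P}(\mathcal{Y})$ with $\mu_i\ne\pi$ for every $i$ it satisfies, for every $T$, $$P_{\max}\le\frac{C}{T},$$ where $C$ is a constant that depends only on $M,K,(\mu_i)_i,\pi$, but not on $T$. In addition, for each hypothesis $S\in\mathcal{S}_K$, as $T\to\infty$, $$\mathbb{E}_S[N^*]\le\frac{-\log P_{\max}\,(1+o(1))}{\min_{i\in S}\ \min_{p\in\mathcal{P}(\mathcal{Y})}\left(D(\mu_i\|p)+(M-2K)D(\pi\|p)\right)}.$$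
   Context: All logarithms are natural. $\mathcal{Y}$ is a finite known set, $\mathcal{P}(\mathcal{Y})$ is the set of probability distributions on $\mathcal{Y}$, and $D(p\|q)=\sum_{y\in\mathcal{Y}}p(y)\log\frac{p(y)}{q(y)}$ is relative entropy. Model. There are $M\ge3$ independent sequences of observations; $Y^{(i)}_k\in\mathcal{Y}$ is the $k$-th observation of the $i$-th sequence, and each sequence is i.i.d. Exactly $K$ of the sequences are outliers, $2<K<M/2$. Let $\pi$ and $\mu_1,\dots,\mu_M$ be full-support distributions on $\mathcal{Y}$ with $\mu_i\ne\pi$ for each $i$ (otherwise arbitrary, and the $\mu_i$ may be arbitrarily distinct from one another). Under the hypothesis $S\in\mathcal{S}_K$ ($S$ is the set of outliers), the first $n$ observations $\mathbf{y}^n$ of all sequences have joint law $$p_S(\mathbf{y}^n)=\prod_{k=1}^n\Big\{\prod_{i\in S}\mu_i(y^{(i)}_k)\prod_{j\notin S}\pi(y^{(j)}_k)\Big\}.$$ There is no null hypothesis. $\mathbb{P}_S,\mathbb{E}_S$ denote probability and expectation under hypothesis $S$. A sequential test is a pair $(N,\delta)$ of a stopping time $N$ and a decision rule $\delta$ which, on $N=n$, maps the first $n$ observations of all sequences to an element of $\mathcal{S}_K$. Its maximal error probability is $P_{\max}=\max_{S\in\mathcal{S}_K}\mathbb{P}_S\{\delta(\mathbf{Y}^N)\ne S\}$. A family of tests indexed by $T$ is universally exponentially consistent if, for all admissible $(\mu_i)_i,\pi$, $P_{\max}\to 0$ as $T\to\infty$ and for each $S\in\mathcal{S}_K$ there is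 $\alpha_S>0$ such that $\mathbb{E}_S[N]\le\frac{-\log P_{\max}}{\alpha_S}(1+o(1))$ as $P_{\max}\to0$. The test. At time $n$ let $\gamma_i$ be the empirical distribution of the first $n$ observations of sequence $i$. For $S\in\mathcal{S}_K$ put $$G_n(S)=\sum_{j\notin S}D\Big(\gamma_j\,\Big\|\,\tfrac{1}{M-|S|}\sum_{k\notin S}\gamma_k\Big)$$ and let $\hat S=\hat S(\mathbf{Y}^n)\in\operatorname{argmin}_{S\in\mathcal{S}_K}G_n(S)$. Then $N^*$ is the smallest $n\ge1$ such that $$\min_{S'\in\mathcal{S}_K,\,S'\ne\hat S}\ n\big[G_n(S')-G_n(\hat S)\big]>\log T+(M+1)|\mathcal{Y}|\log(n+1),$$ and $\delta^*=\hat S(\mathbf{Y}^{N^*})$. *)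

(* Defs.v *)
From HB Require Import structures.
From mathcomp Require Import all_boot all_order all_algebra.
From mathcomp Require Import all_classical all_reals all_analysis.

Set Implicit Arguments.
Unset Strict Implicit.
Unset Printing Implicit Defensive.

Import Order.TTheory GRing.Theory Num.Theory.
Import numFieldNormedType.Exports.

Local Open Scope classical_set_scope.
Local Open Scope ring_scope.
Local Open Scope ereal_scope.

Section Distributions.
Variables (R : realType) (Y : finType).

Definition is_dist (p : {ffun Y -> R}) : Prop :=
  (forall y, (0 <= p y)%R) /\ (\sum_y p y = 1)%R.

Definition full_support (p : {ffun Y -> R}) : Prop := forall y, (0 < p y)%R.

(* Extended-real conventions ([0^-1 = +oo], [lne 0 = -oo], [lne +oo = +oo],
   [0 * _ = 0]) give a summand 0 when [p y = 0] and +oo when [q y = 0 < p y]. *)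
Definition KL (p q : {ffun Y -> R}) : \bar R :=
  \sum_y (p y)%:E * lne ((p y)%:E / (q y)%:E).

End Distributions.

(* A hypothesis is the set of outliers, so this type is the collection of all
   K-element subsets of the index set. *)
Definition hypothesis (M K : nat) := {S : {set 'I_M} | #|S| == K}.

(* One time step: a simultaneous observation of the M sequences. *)
Definition obs_vec (M : nat) (Y : finType) := {ffun 'I_M -> Y}.

Section Model.
Variables (R : realType) (Y : finType) (M K : nat).

Definition admissible (mu : 'I_M -> {ffun Y -> R}) (pi : {ffun Y -> R}) : Prop :=
  [/\ is_dist pi, full_support pi,
      forall i, is_dist (mu i), forall i, full_support (mu i)
    & forall i, mu i != pi].

Definition joint_law (mu : 'I_M -> {ffun Y -> R}) (pi : {ffun Y -> R})
    (S : {set 'I_M}) (s : seq (obs_vec M Y)) : R :=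
  (\prod_(x <- s) ((\prod_(i in S) mu i (x i)) *
                   (\prod_(j | j \notin S) pi (x j))))%R.

(* The observation process on an arbitrary sample space, with one probability
   measure per hypothesis.  The law of every finite prefix is prescribed, which
   determines the law of the whole process. Times are numbered from 0. *)
Record outlier_model (mu : 'I_M -> {ffun Y -> R}) (pi : {ffun Y -> R})
    (d : measure_display) (Omega : measurableType d) := OutlierModel {
  obs : nat -> Omega -> obs_vec M Y;
  Pr : hypothesis M K -> probability Omega R;
  obs_measurable : forall k x, measurable [set w | obs k w = x];
  obs_law : forall (S : hypothesis M K) (s : seq (obs_vec M Y)),
    Pr S [set w | mkseq (fun k => obs k w) (size s) = s]
      = (joint_law mu pi (val S) s)%:E
}.

(* The stopping time is the first n such that [stops] accepts the first n
   observations: any stopping time of the filtration of the observations has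
   this form. *)
Record seq_test := SeqTest {
  stops : seq (obs_vec M Y) -> bool;
  decision : seq (obs_vec M Y) -> hypothesis M K
}.

Section TestPerformance.
Variables (mu : 'I_M -> {ffun Y -> R}) (pi : {ffun Y -> R}).
Variables (d : measure_display) (Omega : measurableType d).
Variables (X : outlier_model mu pi Omega) (t : seq_test).

Definition hist (n : nat) (w : Omega) : seq (obs_vec M Y) :=
  mkseq (fun k => obs X k w) n.

Definition stops_first (n : nat) (w : Omega) : Prop :=
  stops t (hist n w) /\ forall m, (m < n)%N -> ~~ stops t (hist m w).

(* Equal to +oo when the test never stops. *)
Definition stopping_time (w : Omega) : \bar R :=
  ereal_inf [set n%:R%:E | n in [set n | stops t (hist n w)]].

(* A run that never stops counts as an error. *)
Definition error_event (S : hypothesis M K) : set Omega :=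
  [set w | ~ exists n, stops_first n w /\ decision t (hist n w) = S].

Definition Pmax : \bar R :=
  \big[maxe/-oo]_(S : hypothesis M K) Pr X S (error_event S).

Definition expected_time (S : hypothesis M K) : \bar R :=
  \int[Pr X S]_w stopping_time w.

End TestPerformance.

(* [f <= g (1 + o(1))] along the filter [F]. *)
Definition asymp_le (F : set_system R) (f g : R -> \bar R) : Prop :=
  exists o : R -> R, o x @[x --> F] --> (0 : R)%R /\
    \forall x \near F, f x <= g x * (1 + o x)%R%:E.

(* The filter "f(T) --> 0" on the parameters T > 0. *)
Definition vanishing (f : R -> \bar R) : set_system R :=
  filter_from [set e : R | (0 < e)%R]
    (fun e => [set T : R | (0 < T)%R /\ f T < e%:E]).

Definition universally_exponentially_consistent (t : R -> seq_test) : Prop :=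
  forall (mu : 'I_M -> {ffun Y -> R}) (pi : {ffun Y -> R}),
  admissible mu pi ->
  forall (d : measure_display) (Omega : measurableType d)
    (X : outlier_model mu pi Omega),
  Pmax X (t T) @[T --> +oo%R] --> 0 /\
  forall S : hypothesis M K, exists2 alpha : R, (0 < alpha)%R &
    asymp_le (vanishing (fun T => Pmax X (t T)))
      (fun T => expected_time X (t T) S)
      (fun T => - lne (Pmax X (t T)) / alpha%:E).

End Model.

Section Test.
Variables (R : realType) (Y : finType) (M K : nat).

Definition empirical (s : seq (obs_vec M Y)) (i : 'I_M) : {ffun Y -> R} :=
  [ffun y => (count (fun x : obs_vec M Y => x i == y) s)%:R / (size s)%:R]%R.

Definition mean_empirical (s : seq (obs_vec M Y)) (S : {set 'I_M}) :
    {ffun Y -> R} :=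
  [ffun y => (M - #|S|)%:R^-1 * \sum_(k | k \notin S) empirical s k y]%R.

Definition G (s : seq (obs_vec M Y)) (S : {set 'I_M}) : \bar R :=
  \sum_(j | j \notin S) KL (empirical s j) (mean_empirical s S).

(* Ties are broken arbitrarily. *)
Definition is_argmin (Shat : seq (obs_vec M Y) -> hypothesis M K) : Prop :=
  forall s (S : hypothesis M K), G s (val (Shat s)) <= G s (val S).

Definition outlier_test (Shat : seq (obs_vec M Y) -> hypothesis M K) (T : R) :
    seq_test Y M K :=
  {| stops := fun s =>
       (0 < size s)%N &&
       ((ln T + (M.+1 * #|Y|)%:R * ln (size s).+1%:R)%R%:E <
        \big[mine/+oo]_(S' : hypothesis M K | S' != Shat s)
          ((size s)%:R%:E * (G s (val S') - G s (val (Shat s)))));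
     decision := Shat |}.

(* The infimum over p is attained (relative entropy is lower semicontinuous on
   the simplex), so it is a minimum. *)
Definition exponent (mu : 'I_M -> {ffun Y -> R}) (pi : {ffun Y -> R})
    (S : {set 'I_M}) : \bar R :=
  \big[mine/+oo]_(i in S)
    ereal_inf [set KL (mu i) p + (M - 2 * K)%:R%:E * KL pi p
              | p in [set p | is_dist p]].

End Test.

(* Main.v *)
Require Import Defs.
From mathcomp Require Import all_boot all_order all_algebra.
From mathcomp Require Import all_classical all_reals all_analysis.
From mathcomp Require Import ring lra zify.

Set Implicit Arguments.
Unset Strict Implicit.
Unset Printing Implicit Defensive.

Import Order.TTheory GRing.Theory Num.Theory.
Import numFieldNormedType.Exports.

(** Write [gamma_i] for the empirical distributions at time [n] and [nu_i] for the
    law of the [i]-th sequence under the true set of outliers [S]: [mu_i] if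
    [i] is in [S], and [pi] otherwise.

    Error probability. If the test stops at time [n] with a decision other than
    [S], then [n G_n(S)] exceeds the threshold. The mean of the [gamma_j]
    minimizes the sum of the divergences, so [G_n(S)] is at most the sum of the
    [D(gamma_i || nu_i)] ([scatter_le], [wrong_stop_scatter]). The likelihood of a
    sample is its likelihood under the laws [gamma_i] times the exponential of
    minus [n] times that sum ([prod_law_empirical]), and the likelihoods under the
    empirical laws add up to at most the number of types [(n + 1)^(M |Y|)]
    ([sum_max_likelihood]). Hence a wrong decision at time [n] has probability at
    most [T^-1 (n + 1)^-|Y|] ([Pr_wrong_stop]). As [mu_i <> pi], the alphabet has
    at least two letters, so these bounds sum to at most [T^-1], and the constant
    [C = 1] works ([Pr_error_le]).

    Stopping time. The statistic [G] is a continuous function of the empirical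
    distributions near the full-support [nu_i] ([cvg_scatter]). At [nu] it is 0
    for the true [S]; a wrong guess [S'] leaves out at least one outlier [i] and
    at least [M - 2K] typical sequences, so there [G] is at least the exponent
    ([exponent_le_scatter]). Therefore, for every rate [a'] below the exponent,
    past a time of order [ln T / a'] the test can only continue while some
    [gamma_i] stays away from [nu_i] ([stops_after]). By a Chernoff bound the
    probabilities of these deviations are summable ([sum_deviation_prob]), so
    [E_S[N] <= max(ln T, 0) / a' + B] with [B] independent of [T]
    ([expected_time_le]).

    The exponent is positive because relative entropy dominates the squared
    Hellinger distance ([exponent_fin_gt0]). Since [- ln Pmax >= max(ln T, 0)], the
    bound on the expected time gives the asymptotics as [T] tends to infinity by
    letting [a'] increase to the exponent, and it gives exponential consistency
    as [Pmax] tends to 0 for any fixed rate below the exponent. *)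

Local Open Scope classical_set_scope.
Local Open Scope ring_scope.

(** * Sums, limits and integrals *)

Section Preliminaries.
Context {R : realType}.

Lemma sum_tuple_prod (X : finType) (h : X -> R) n :
  \sum_(s : n.-tuple X) \prod_(x <- s) h x = (\sum_x h x) ^+ n.
Proof.
rewrite -[in RHS](card_ord n) -prodr_const bigA_distr_bigA/=.
rewrite (reindex (fun f : {ffun 'I_n -> X} => [tuple f i | i < n]))/=.
  by apply: eq_bigr => f _; rewrite (big_tuple _ _ [tuple f i | i < n]);
     apply: eq_bigr => i _; rewrite tnth_mktuple.
exists (fun s : n.-tuple X => [ffun i => tnth s i]) => [f _|s _].
  by apply/ffunP => i; rewrite ffunE tnth_mktuple.
by apply: eq_from_tnth => i; rewrite tnth_mktuple ffunE.
Qed.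

Lemma geometric_sum_le (r : R) N : 0 <= r -> r < 1 ->
  \sum_(n < N) r ^+ n <= (1 - r)^-1.
Proof.
move=> r0 r1; rewrite -[leRHS]mul1r ler_pdivlMr ?subr_gt0//.
have := subrX1 r N; have := exprn_ge0 N r0; nra.
Qed.

Lemma expR_le_quadratic (x : R) : x <= 2^-1 -> expR x <= 1 + x + 2 * x ^+ 2.
Proof.
move=> x2; have x1 : 0 < 1 - x by lra.
have : 1 - x <= expR (- x) by exact: expR_ge1Dx.
rewrite expRN -lef_pV2 ?posrE ?invr_gt0 ?expR_gt0// invrK => /le_trans; apply.
rewrite -[leLHS]mul1r ler_pdivrMr//; have := sqr_ge0 x; nra.
Qed.

Lemma cvg_sum_real (T I : Type) (F : set_system T) (FF : Filter F) (r : seq I)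
    (P : pred I) (f : I -> T -> R) (a : I -> R) :
  (forall i, P i -> f i x @[x --> F] --> a i) ->
  \sum_(i <- r | P i) f i x @[x --> F] --> \sum_(i <- r | P i) a i.
Proof.
move=> fa; elim: r => [|i r IH].
  rewrite big_nil; under eq_fun do rewrite big_nil; exact: cvg_cst.
rewrite big_cons; under eq_fun do rewrite big_cons.
by case: ifP => // Pi; apply: cvgD => //; exact: fa.
Qed.

(** On non-negative functions the integral is a supremum over the simple
    functions below the integrand, hence monotone without measurability. *)
Lemma ge0_integral_mono d (Omega : measurableType d)
    (P : {measure set Omega -> \bar R}) (f g : Omega -> \bar R) :
  (forall w, 0 <= f w)%E -> (forall w, f w <= g w)%E ->
  (\int[P]_w f w <= \int[P]_w g w)%E.
Proof.
move=> f0 fg; have g0 w : (0 <= g w)%E by exact: le_trans (fg w).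
rewrite !ge0_integralTE//; apply: ereal_sup_le => _ [h hf <-].
by exists h => // w; exact: le_trans (fg w).
Qed.

Lemma ln_le_linear (c e : R) : 0 <= c -> 0 < e ->
  exists2 n0 : nat, (0 < n0)%N & forall n, (n0 <= n)%N -> c * ln n.+1%:R <= n%:R * e.
Proof.
move=> c0 e0.
(* [ln (n + 1) = 2 ln r <= 2 r] with [r] the square root of [n + 1], so it is enough
   that [2 c r <= e r^2 / 2]. *)
pose b := (4 * c / e) ^+ 2.
exists (Num.truncn b).+1 => // n bn.
pose r := Num.sqrt (n.+1%:R : R).
have r0 : 0 < r by rewrite sqrtr_gt0 ltr0n.
have rE : n.+1%:R = r ^+ 2 by rewrite sqr_sqrtr.
have n1 : 1 <= n%:R :> R by rewrite ler1n (leq_trans _ bn).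
have nE : n%:R + 1 = r ^+ 2 by rewrite -rE -natr1.
have b0 : 0 <= 4 * c / e by rewrite divr_ge0 ?mulr_ge0// ltW.
have br : 4 * c / e <= r.
  rewrite -(ler_pXn2r (n := 2)) ?nnegrE// ?(ltW r0)// -rE.
  by rewrite ltW// (lt_le_trans (truncnS_gt b))// ler_nat ltnW.
have {}br : 4 * c <= r * e by rewrite -ler_pdivrMr.
rewrite rE lnXn// -mulr_natl.
have lr := ln_sublinear r0.
have : c * ln r <= c * r by rewrite ler_wpM2l// ltW.
nra.
Qed.

End Preliminaries.

(** * Relative entropy *)

Section RelativeEntropy.
Context {R : realType} {Y : finType}.
Implicit Types p q r : {ffun Y -> R}.

(** Real-valued relative entropy. With [ln 0 = 0] and division by 0 equal to 0,
    it agrees with [KL p q] as soon as [p] is absolutely continuous with respect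
    to [q]. *)
Definition rel_ent p q : R := \sum_y p y * ln (p y / q y).

(** Absolute continuity of [p] with respect to [q], for non-negative [p], [q]. *)
Definition abs_cont p q : Prop := forall y, 0 < p y -> 0 < q y.

(** Twice the squared Hellinger distance. *)
Definition hellinger p q : R :=
  \sum_y (Num.sqrt (p y) - Num.sqrt (q y)) ^+ 2.

Lemma full_support_abs_cont p q : full_support q -> abs_cont p q.
Proof. by move=> q0 y _. Qed.

Lemma KL_rel_ent p q : (forall y, 0 <= p y) -> abs_cont p q ->
  KL p q = (rel_ent p q)%:E.
Proof.
move=> p0 pq; rewrite /KL /rel_ent -sumEFin; apply: eq_bigr => y _.
have := p0 y; rewrite le_eqVlt => /predU1P[<-|py]; first by rewrite !mul0e mul0r.
have qy := pq _ py.
rewrite inver gt_eqF// -EFinM lne_EFin ?divr_gt0//.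
Qed.

(** Concavity of the logarithm in the form [ln z <= z - 1] at
    [z = sqrt (b / a)]. *)
Lemma hellinger_term (a b : R) : 0 <= a -> 0 <= b ->
  ((2 * a - 2 * (Num.sqrt a * Num.sqrt b))%:E <= a%:E * lne (a%:E / b%:E))%E.
Proof.
rewrite le_eqVlt => /predU1P[<-|a0] b0.
  by rewrite sqrtr0 !(mul0r,mulr0) subr0 mul0e.
move: b0; rewrite le_eqVlt => /predU1P[<-|b0].
  by rewrite inve0 gt0_muley ?lte_fin//= gt0_muley ?lte_fin// leey.
rewrite inver gt_eqF// -EFinM lne_EFin ?divr_gt0// -EFinM lee_fin.
have sa : (0 < Num.sqrt a) by rewrite sqrtr_gt0.
have sb : (0 < Num.sqrt b) by rewrite sqrtr_gt0.
rewrite -[in ln _](sqr_sqrtr (ltW a0)) -[in ln _](sqr_sqrtr (ltW b0)).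
rewrite -expr_div_n lnXn ?divr_gt0//.
set x := Num.sqrt a in sa *; set y := Num.sqrt b in sb *.
have -> : a = x ^+ 2 by rewrite sqr_sqrtr// ltW.
have h : (ln (y / x) <= y / x - 1).
  have := @le_ln1Dx R (y / x - 1); rewrite subrKC; apply.
  by rewrite ltrBrDl subrr divr_gt0.
have -> : ln (x / y) = (- ln (y / x)) by rewrite -invf_div lnV ?posrE ?divr_gt0.
have : (x ^+ 2 * ln (y / x) <= x ^+ 2 * (y / x - 1)).
  by rewrite ler_wpM2l// sqr_ge0.
have -> : (x ^+ 2 * (y / x - 1) = x * y - x ^+ 2) by field; rewrite gt_eqF.
move=> {}h; rewrite -mulr_natr; nra.
Qed.

(** Relative entropy dominates the squared Hellinger distance, also where it is
    infinite. *)
Lemma hellinger_le_KL p q : is_dist p -> is_dist q ->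
  ((hellinger p q)%:E <= KL p q)%E.
Proof.
move=> [p0 p1] [q0 q1].
suff -> : hellinger p q =
    (\sum_y (2 * p y - 2 * (Num.sqrt (p y) * Num.sqrt (q y)))).
  by rewrite -sumEFin; apply: lee_sum => y _; exact: hellinger_term.
rewrite /hellinger; transitivity
  (\sum_y (p y + q y - 2 * (Num.sqrt (p y) * Num.sqrt (q y)))).
  apply: eq_bigr => y _; rewrite sqrrB !sqr_sqrtr// -mulr_natl; ring.
rewrite !sumrB big_split/= p1 q1 -[in RHS]mulr_sumr p1; congr (_ - _); ring.
Qed.

Lemma hellinger_ge0 p q : 0 <= hellinger p q.
Proof. by apply: sumr_ge0 => y _; exact: sqr_ge0. Qed.

Lemma KL_ge0 p q : is_dist p -> is_dist q -> (0 <= KL p q)%E.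
Proof.
move=> dp dq; apply: le_trans (hellinger_le_KL dp dq).
by rewrite lee_fin hellinger_ge0.
Qed.

Lemma rel_ent_ge0 p q : is_dist p -> is_dist q -> abs_cont p q ->
  0 <= rel_ent p q.
Proof.
by move=> dp dq pq; rewrite -lee_fin -KL_rel_ent ?KL_ge0//; case: dp.
Qed.

Lemma rel_ent_refl p : (forall y, 0 <= p y) -> rel_ent p p = 0.
Proof.
move=> p0; rewrite /rel_ent big1// => y _.
have := p0 y; rewrite le_eqVlt => /predU1P[<-|py]; first by rewrite mul0r.
by rewrite divff ?gt_eqF// ln1 mulr0.
Qed.

Lemma hellinger_gt0 p q : is_dist p -> is_dist q -> p != q ->
  0 < hellinger p q.
Proof.
move=> [p0 _] [q0 _]; apply: contraNT; rewrite -leNgt => h.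
apply/eqP/ffunP => y.
have /eqP : hellinger p q == 0 by rewrite eq_le h hellinger_ge0.
rewrite /hellinger => /eqP; rewrite psumr_eq0; last by move=> *; exact: sqr_ge0.
move=> /allP /(_ y (mem_index_enum _)) /=; rewrite sqrf_eq0 subr_eq0 => /eqP e.
by rewrite -(sqr_sqrtr (p0 y)) -(sqr_sqrtr (q0 y)) e.
Qed.

Lemma hellinger_triangle p q r :
  hellinger p q <= 2 * (hellinger p r + hellinger q r).
Proof.
rewrite /hellinger -big_split/= mulr_sumr; apply: ler_sum => y _.
set a := Num.sqrt (p y); set b := Num.sqrt (q y); set c := Num.sqrt (r y).
have := sqr_ge0 (a + b - 2 * c); nra.
Qed.

(** An alphabet that carries two distinct distributions has at least two
    letters. *)
Lemma dist_neq_card p q : is_dist p -> is_dist q -> p != q -> (1 < #|Y|)%N.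
Proof.
move=> [_ p1] [_ q1]; rewrite ltnNge; apply: contraNN => Y1.
apply/eqP/ffunP => y.
have sgl (f : {ffun Y -> R}) : (\sum_z f z) = f y.
  rewrite (bigD1 y)//= big1 ?addr0// => z.
  by rewrite (fintype_le1P Y1 z y) eqxx.
by rewrite -sgl p1 -q1 sgl.
Qed.

End RelativeEntropy.

(** * Laws of finite histories *)

Section ProductLaws.
Context {R : realType} {Y : finType} {M : nat}.
Implicit Types (nu g : 'I_M -> {ffun Y -> R}) (s : seq (obs_vec M Y)).

(** The law of the [i]-th sequence when [S] is the set of outliers. *)
Definition seq_law (mu : 'I_M -> {ffun Y -> R}) (pi : {ffun Y -> R})
    (S : {set 'I_M}) (i : 'I_M) : {ffun Y -> R} :=
  if i \in S then mu i else pi.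

(** Likelihood of [s] when the sequences are independent and the [i]-th one is
    i.i.d. with law [nu i]. *)
Definition prod_law nu s : R := \prod_(x <- s) \prod_i nu i (x i).

Lemma joint_lawE mu pi (S : {set 'I_M}) s :
  joint_law mu pi S s = prod_law (seq_law mu pi S) s.
Proof.
apply: eq_bigr => x _; rewrite [RHS](bigID (mem S))/=; congr (_ * _).
  by apply: eq_bigr => i iS; rewrite /seq_law iS.
by apply: eq_bigr => i /negbTE iS; rewrite /seq_law iS.
Qed.

Lemma sum_obs_vec nu : (forall i, \sum_y nu i y = 1) ->
  \sum_(x : obs_vec M Y) \prod_i nu i (x i) = 1.
Proof.
move=> nu1; rewrite -(bigA_distr_bigA (fun i y => nu i y)).
by rewrite big1// => i _; rewrite nu1.
Qed.

Lemma sum_prod_law nu n : (forall i, \sum_y nu i y = 1) ->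
  \sum_(s : n.-tuple (obs_vec M Y)) prod_law nu s = 1.
Proof. by move=> nu1; rewrite sum_tuple_prod sum_obs_vec// expr1n. Qed.

Lemma prod_law_ge0 nu s : (forall i y, 0 <= nu i y) -> 0 <= prod_law nu s.
Proof. by move=> nu0; apply: prodr_ge0 => x _; apply: prodr_ge0. Qed.

(** Marginalization to a single coordinate. *)
Lemma expect_coord nu (i0 : 'I_M) (f : Y -> R) :
  (forall i, \sum_y nu i y = 1) ->
  \sum_(x : obs_vec M Y) (\prod_i nu i (x i)) * f (x i0) =
  \sum_y nu i0 y * f y.
Proof.
move=> nu1.
transitivity (\sum_(x : obs_vec M Y)
    \prod_i (nu i (x i) * (if i == i0 then f (x i) else 1))).
  apply: eq_bigr => x _; rewrite big_split/=; congr (_ * _).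
  by rewrite -big_mkcond big_pred1_eq.
rewrite -(bigA_distr_bigA (fun i y => nu i y * (if i == i0 then f y else 1))).
rewrite (bigD1 i0)//= eqxx [X in _ * X]big1 ?mulr1// => i /negbTE ->.
by under eq_bigr do rewrite mulr1; rewrite nu1.
Qed.

End ProductLaws.

Section HistoryEvents.
Context {R : realType} {Y : finType} {M K : nat}.
Variables (mu : 'I_M -> {ffun Y -> R}) (pi : {ffun Y -> R}).
Variables (d : measure_display) (Omega : measurableType d).
Variable X : outlier_model K mu pi Omega.
Implicit Types (A : pred (seq (obs_vec M Y))) (S : hypothesis M K).

(** The event that the first [n] observations satisfy [A]. *)
Definition hist_event n A : set Omega := [set w | A (hist X n w)].

Lemma size_hist n w : size (hist X n w) = n.
Proof. exact: size_mkseq. Qed.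

Lemma measurable_hist_eq n s : measurable [set w | hist X n w = s].
Proof.
have [sn|sn] := eqVneq (size s) n; last first.
  rewrite (_ : [set _ | _] = set0)// -subset0 => w /= ws.
  by move: sn; rewrite -ws size_mkseq eqxx.
case: s sn => [|x0 s'] sn.
  rewrite (_ : [set _ | _] = setT)//; apply/seteqP; split => // w _ /=.
  by apply: size0nil; rewrite size_mkseq -sn.
set s := x0 :: s' in sn *.
rewrite (_ : [set _ | _] =
    \bigcap_(k in [set k | (k < n)%N]) [set w | obs X k w = nth x0 s k]).
  by apply: bigcap_measurableType => k _; exact: obs_measurable.
apply/seteqP; split => w /=.
  by move=> ws k /= kn; rewrite -ws nth_mkseq.
move=> H; apply: (@eq_from_nth _ x0); first by rewrite size_mkseq.
by move=> k; rewrite size_mkseq => kn; rewrite nth_mkseq// H.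
Qed.

Lemma hist_eventE n A : hist_event n A =
  \bigcup_(s in [set: n.-tuple (obs_vec M Y)])
    (if A s then [set w | hist X n w = s] else set0).
Proof.
apply/seteqP; split => w /=.
  move=> Aw; have sw : size (hist X n w) == n by rewrite size_mkseq.
  by exists (Tuple sw) => //=; rewrite Aw.
by move=> [s _]; case: ifP => // As /= ws; rewrite /hist_event/= ws.
Qed.

Lemma measurable_hist_event n A : measurable (hist_event n A).
Proof.
rewrite hist_eventE; apply: fin_bigcup_measurable; first exact: finite_finset.
by move=> s _; case: ifP => // _; exact: measurable_hist_eq.
Qed.

Lemma Pr_hist_event S n A : (Pr X S (hist_event n A) =
  (\sum_(s : n.-tuple (obs_vec M Y) | A s)
     prod_law (seq_law mu pi (val S)) s)%:E)%E.
Proof.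
rewrite hist_eventE measure_fin_bigcup//=.
- have -> : [set: n.-tuple (obs_vec M Y)] =
      [set` index_enum (n.-tuple (obs_vec M Y))].
    by apply/seteqP; split => // s _ /=; exact: mem_index_enum.
  rewrite -fsbig_seq ?index_enum_uniq// [in RHS]big_mkcond/= -sumEFin.
  apply: eq_bigr => s _; case: ifP => As; last by rewrite measure0.
  by rewrite -joint_lawE -(obs_law X) size_tuple.
- move=> s t _ _ [w []]; case: ifP => // _ /= ws; case: ifP => // _ /= wt.
  by apply: val_inj; exact: etrans (esym ws) wt.
- by move=> s _; case: ifP => // _; exact: measurable_hist_eq.
Qed.

End HistoryEvents.

(** * The scatter statistic *)

Section ScatterStatistic.
Context {R : realType} {Y : finType} {M : nat}.
Implicit Types (g : 'I_M -> {ffun Y -> R}) (S : {set 'I_M}) (pi : {ffun Y -> R}).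

(** Mean of the distributions outside [S]. *)
Definition mean_off g S : {ffun Y -> R} :=
  [ffun y => (M - #|S|)%:R^-1 * \sum_(k | k \notin S) g k y].

(** Scatter of the distributions outside [S] around their mean: the statistic [G]
    as a real function of arbitrary distributions. *)
Definition scatter g S : R :=
  \sum_(j | j \notin S) rel_ent (g j) (mean_off g S).

Lemma card_lt_notin S j : j \notin S -> (#|S| < M)%N.
Proof.
move=> jS; rewrite -[M in (_ < M)%N]card_ord -cardsT; apply: proper_card.
by apply/properP; split; [exact: finset.subsetT|exists j].
Qed.

Lemma card_notin S : #|[pred k | k \notin S]| = (M - #|S|)%N.
Proof.
rewrite -[M in (M - _)%N]card_ord -(cardC (mem S)) addnC addnK.
exact: eq_card.
Qed.

Lemma mean_off_ge0 g S : (forall j y, 0 <= g j y) -> forall y, 0 <= mean_off g S y.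
Proof. by move=> g0 y; rewrite ffunE mulr_ge0// sumr_ge0. Qed.

Lemma abs_cont_mean_off g S j : (forall j y, 0 <= g j y) -> j \notin S ->
  abs_cont (g j) (mean_off g S).
Proof.
move=> g0 jS y gy; rewrite ffunE mulr_gt0//.
  by rewrite invr_gt0 ltr0n subn_gt0 (card_lt_notin jS).
by rewrite (bigD1 j)//= ltr_wpDr// sumr_ge0.
Qed.

Lemma mean_off_dist g S j : j \notin S -> (forall j, is_dist (g j)) ->
  is_dist (mean_off g S).
Proof.
move=> jS gd; split; first by apply: mean_off_ge0 => k; case: (gd k).
under eq_bigr do rewrite ffunE.
rewrite -mulr_sumr exchange_big/= (eq_bigr (fun=> 1)); last first.
  by move=> k _; case: (gd k).
rewrite sumr_const card_notin mulVf// pnatr_eq0 -lt0n subn_gt0.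
exact: card_lt_notin jS.
Qed.

Lemma scatter_ge0 g S : (forall j, is_dist (g j)) -> 0 <= scatter g S.
Proof.
move=> gd; apply: sumr_ge0 => j jS.
apply: rel_ent_ge0 => //; first exact: mean_off_dist jS gd.
by apply: abs_cont_mean_off => // k; case: (gd k).
Qed.

(** The mean minimizes the scatter: replacing it by [pi] adds [M - #|S|] times
    the relative entropy of the mean with respect to [pi]. *)
Lemma scatter_le g S pi : (forall j, is_dist (g j)) ->
  is_dist pi -> full_support pi ->
  scatter g S <= \sum_(j | j \notin S) rel_ent (g j) pi.
Proof.
move=> gd dpi pi0.
have g0 j y : 0 <= g j y by case: (gd j).
case: (pickP [pred j | j \notin S]) => [j0 /= jS|nS]; last first.
  by rewrite /scatter !big_pred0.
rewrite -subr_ge0 /scatter -sumrB.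
suff -> : \sum_(j | j \notin S) (rel_ent (g j) pi - rel_ent (g j) (mean_off g S))
    = (M - #|S|)%:R * rel_ent (mean_off g S) pi.
  apply: mulr_ge0 => //; apply: rel_ent_ge0 => //; exact: mean_off_dist jS gd.
transitivity (\sum_(j | j \notin S) \sum_y g j y * ln (mean_off g S y / pi y)).
  apply: eq_bigr => j jnS; rewrite -sumrB; apply: eq_bigr => y _.
  have := g0 j y; rewrite le_eqVlt => /predU1P[<-|gy]; first by rewrite !mul0r subr0.
  have my := abs_cont_mean_off g0 jnS gy.
  have py : 0 < pi y by [].
  rewrite !ln_div ?posrE//; ring.
rewrite exchange_big /= mulr_sumr; apply: eq_bigr => y _.
rewrite -mulr_suml mulrA; congr (_ * _); rewrite ffunE mulrA mulfV ?mul1r//.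
by rewrite pnatr_eq0 -lt0n subn_gt0 (card_lt_notin jS).
Qed.

End ScatterStatistic.

(** * Types and the probability of a wrong decision *)

Section Types.
Context {R : realType} {Y : finType} {M : nat}.
Implicit Types (nu g : 'I_M -> {ffun Y -> R}) (s : seq (obs_vec M Y)).

Lemma empirical_ge0 s i y : 0 <= empirical R s i y.
Proof. by rewrite ffunE. Qed.

Lemma G_scatter s (S : {set 'I_M}) : G R s S = (scatter (empirical R s) S)%:E.
Proof.
rewrite /G /scatter -sumEFin; apply: eq_bigr => j jS.
have e0 := @empirical_ge0 s.
by rewrite KL_rel_ent//; exact: abs_cont_mean_off.
Qed.

Lemma sum_count s i (F : Y -> R) :
  \sum_(x <- s) F (x i) =
  \sum_y (count (fun x : obs_vec M Y => x i == y) s)%:R * F y.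
Proof.
elim: s => [|x s IH]; first by rewrite big_nil big1// => y _; rewrite mul0r.
rewrite big_cons IH; under [RHS]eq_bigr do rewrite /= natrD mulrDl.
rewrite big_split/=; congr (_ + _).
rewrite (bigD1 (x i))//= eqxx mul1r big1 ?addr0// => y /negbTE yx.
by rewrite eq_sym yx mul0r.
Qed.

Lemma sum_empirical s i (F : Y -> R) :
  \sum_(x <- s) F (x i) = (size s)%:R * \sum_y empirical R s i y * F y.
Proof.
case: s => [|x0 s']; first by rewrite big_nil mul0r.
rewrite sum_count mulr_sumr; apply: eq_bigr => y _; rewrite ffunE mulrA.
by rewrite mulrCA mulfV ?mulr1// pnatr_eq0.
Qed.

Lemma empirical_dist s i : (0 < size s)%N -> is_dist (empirical R s i).
Proof.
move=> s0; split; first exact: empirical_ge0.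
have := sum_empirical s i (fun=> 1).
rewrite big_const_seq count_predT iter_addr_0 -[LHS]mulr1.
move/(mulfI _); rewrite pnatr_eq0 -lt0n => /(_ s0) ->.
by apply: eq_bigr => y _; rewrite mulr1.
Qed.

Lemma prod_law_expR g s : (forall i x, x \in s -> 0 < g i (x i)) ->
  prod_law g s =
  expR ((size s)%:R * \sum_i \sum_y empirical R s i y * ln (g i y)).
Proof.
move=> g0; rewrite /prod_law exchange_big/= mulr_sumr expR_sum.
apply: eq_bigr => i _; rewrite -(sum_empirical s i (fun y => ln (g i y))) expR_sum.
by apply: eq_big_seq => x xs; rewrite lnK// posrE g0.
Qed.

(** The likelihood depends on the observations through their empirical
    distributions only, and is maximal for these distributions. *)
Lemma prod_law_empirical nu s : (forall i, full_support (nu i)) ->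
  prod_law nu s = prod_law (empirical R s) s *
    expR (- ((size s)%:R * \sum_i rel_ent (empirical R s i) (nu i))).
Proof.
move=> nu0; rewrite (prod_law_expR (g := nu)); last by move=> i x _; exact: nu0.
rewrite prod_law_expR; last first.
  move=> i x xs; rewrite ffunE divr_gt0// ltr0n -?has_count.
    by apply/hasP; exists x.
  by case: s xs.
rewrite -expRD -mulrBr -sumrB; congr (expR (_ * _)); apply: eq_bigr => i _.
rewrite -sumrB; apply: eq_bigr => y _.
have := empirical_ge0 s i y; rewrite le_eqVlt => /predU1P[<-|ey].
  by rewrite !mul0r subr0.
have ny : 0 < nu i y by apply: nu0.
rewrite ln_div ?posrE//; ring.
Qed.

(** Method of types: summing, over all sequences, the likelihood maximized
    over the i.i.d. laws gives at most the number of types. *)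
Lemma sum_max_likelihood n : (0 < n)%N ->
  \sum_(s : n.-tuple (obs_vec M Y)) prod_law (empirical R s) s
    <= n.+1%:R ^+ (M * #|Y|).
Proof.
move=> n0.
pose type := {ffun 'I_M -> {ffun Y -> 'I_n.+1}}.
pose law_of (t : type) (i : 'I_M) : {ffun Y -> R} := [ffun y => (t i y)%:R / n%:R].
pose ok (t : type) := [forall i, \sum_y (t i y : nat) == n].
have n0R : (n%:R : R) != 0 by rewrite pnatr_eq0 -lt0n.
have ge0 (t : type) (s : n.-tuple (obs_vec M Y)) : 0 <= prod_law (law_of t) s.
  by apply: prod_law_ge0 => i y; rewrite ffunE divr_ge0.
apply: (@le_trans _ _ (\sum_(s : n.-tuple (obs_vec M Y))
    \sum_(t | ok t) prod_law (law_of t) s)).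
  apply: ler_sum => s _.
  pose cnt i y := count (fun x : obs_vec M Y => x i == y) s.
  have cn i y : (cnt i y < n.+1)%N by rewrite ltnS -(size_tuple s) count_size.
  pose t0 : type := [ffun i => [ffun y => inord (cnt i y)]].
  have t0E i y : t0 i y = cnt i y :> nat by rewrite !ffunE inordK.
  have -> : prod_law (empirical R s) s = prod_law (law_of t0) s.
    apply: eq_bigr => x _; apply: eq_bigr => i _.
    by rewrite /law_of [RHS]ffunE t0E ffunE size_tuple.
  rewrite (bigD1 t0)/= ?lerDl ?sumr_ge0//.
  apply/forallP => i; rewrite -(eqr_nat R) natr_sum; apply/eqP.
  have := sum_count s i (fun=> 1).
  rewrite big_const_seq count_predT iter_addr_0 size_tuple => ->.
  by apply: eq_bigr => y _; rewrite t0E mulr1.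
rewrite exchange_big/=; apply: (@le_trans _ _ (\sum_(t : type | ok t) 1)).
  apply: ler_sum => t /forallP tok; rewrite sum_prod_law// => i.
  under eq_bigr do rewrite ffunE.
  by rewrite -mulr_suml -natr_sum (eqP (tok i)) divff.
rewrite sumr_const -natrX ler_nat (leq_trans (max_card _))//.
by rewrite !card_ffun !card_ord mulnC expnM.
Qed.

End Types.

Section ErrorAtFixedTime.
Context {R : realType} {Y : finType} {M K : nat}.
Variables (mu : 'I_M -> {ffun Y -> R}) (pi : {ffun Y -> R}).
Variables (d : measure_display) (Omega : measurableType d).
Variable X : outlier_model K mu pi Omega.
Hypothesis adm : admissible mu pi.
Variable Shat : seq (obs_vec M Y) -> hypothesis M K.

Lemma seq_law_dist (S : {set 'I_M}) i : is_dist (seq_law mu pi S i).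
Proof. by case: adm => ? ? ? ? ?; rewrite /seq_law; case: ifP. Qed.

Lemma seq_law_supp (S : {set 'I_M}) i : full_support (seq_law mu pi S i).
Proof. by case: adm => ? ? ? ? ?; rewrite /seq_law; case: ifP. Qed.

(** A wrong decision at time [n] forces the scatter outside the true set of
    outliers, hence the log-likelihood ratio of the empirical distributions to
    the true ones, to exceed the threshold. *)
Lemma wrong_stop_scatter (S : hypothesis M K) (T : R) s :
  stops (outlier_test Shat T) s -> Shat s != S ->
  ln T + (M.+1 * #|Y|)%:R * ln (size s).+1%:R <=
  (size s)%:R * \sum_i rel_ent (empirical R s i) (seq_law mu pi (val S) i).
Proof.
move=> /andP[s0 /bigmin_gtP[_ /(_ S)]] + wrong; rewrite eq_sym => /(_ wrong).
rewrite !G_scatter -EFinB -EFinM lte_fin => /ltW /le_trans; apply.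
have ed i : is_dist (empirical R s i) by exact: empirical_dist.
rewrite ler_wpM2l//.
apply: (@le_trans _ _ (scatter (empirical R s) (val S))).
  by rewrite gerBl scatter_ge0.
have [dpi spi _ _ _] := adm.
apply: (le_trans (scatter_le _ ed dpi spi)).
rewrite [leRHS](bigID (mem (val S)))/= -[leLHS]add0r lerD//.
  apply: sumr_ge0 => i _; apply: rel_ent_ge0 => //; first exact: seq_law_dist.
  exact/full_support_abs_cont/seq_law_supp.
by apply: ler_sum => i /negbTE iS; rewrite /seq_law iS.
Qed.

(** The threshold makes the likelihood of every wrongly stopped sequence smaller
    than its maximized likelihood by a factor [T (n + 1)^((M + 1) |Y|)], and the
    maximized likelihoods add up to at most [(n + 1)^(M |Y|)]. *)
Lemma Pr_wrong_stop (S : hypothesis M K) (T : R) n : 0 < T -> (0 < n)%N ->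
  (Pr X S (hist_event X n
     (fun s => stops (outlier_test Shat T) s && (Shat s != S)))
   <= (T^-1 * (n.+1%:R ^+ #|Y|)^-1)%:E)%E.
Proof.
move=> T0 n0; rewrite Pr_hist_event lee_fin.
set c := ln T + (M.+1 * #|Y|)%:R * ln n.+1%:R.
have cE : expR (- c) = T^-1 * (n.+1%:R ^+ (M.+1 * #|Y|))^-1.
  by rewrite opprD expRD !expRN lnK ?posrE// expRM_natl lnK ?posrE// ltr0n.
apply: (@le_trans _ _ (\sum_(s : n.-tuple (obs_vec M Y))
    prod_law (empirical R s) s * expR (- c))).
  rewrite big_mkcond/=; apply: ler_sum => s _.
  have e0 : 0 <= prod_law (empirical R s) s.
    by apply: prod_law_ge0 => i y; exact: empirical_ge0.
  case: ifP => [/andP[st wr]|_]; last by rewrite mulr_ge0// expR_ge0.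
  rewrite prod_law_empirical; last exact: seq_law_supp.
  rewrite ler_wpM2l// ler_expR lerN2.
  by have := wrong_stop_scatter st wr; rewrite size_tuple.
rewrite -mulr_suml cE.
apply: (@le_trans _ _ (n.+1%:R ^+ (M * #|Y|) *
    (T^-1 * (n.+1%:R ^+ (M.+1 * #|Y|))^-1))).
  apply: ler_wpM2r (sum_max_likelihood n0).
  by rewrite mulr_ge0// invr_ge0// ?exprn_ge0// ltW.
rewrite le_eqVlt; apply/orP; left; apply/eqP.
rewrite mulSn exprD; field.
by rewrite !expf_neq0 ?gt_eqF ?ltr0n.
Qed.

End ErrorAtFixedTime.

(** * Concentration of the empirical distributions *)

Section Concentration.
Context {R : realType}.

(** Chernoff bound for a finitely valued observable of negative mean. *)
Lemma chernoff (X : finType) (p f : X -> R) :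
  (forall x, 0 <= p x) -> \sum_x p x = 1 -> \sum_x p x * f x < 0 ->
  exists r, [/\ 0 <= r, r < 1 & forall n,
    \sum_(s : n.-tuple X | 0 <= \sum_(x <- s) f x) \prod_(x <- s) p x <= r ^+ n].
Proof.
move=> p0 p1 pf.
set m := - \sum_x p x * f x; have m0 : 0 < m by rewrite oppr_gt0.
pose B := 1 + \sum_x `|f x|.
have B1 : 1 <= B by rewrite lerDl sumr_ge0.
have fB x : `|f x| <= B.
  by rewrite /B (bigD1 x)//= addrCA lerDl addr_ge0// sumr_ge0.
have mB : m <= B.
  rewrite -[leRHS]mul1r -p1 mulr_suml /m -sumrN; apply: ler_sum => x _.
  rewrite -mulrN ler_wpM2l// (le_trans (ler_norm _))// normrN; exact: fB.
(* This choice makes the quadratic term of the expansion below at most half of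
   the linear one. *)
pose l := m / (4 * B ^+ 2).
have B0 : 0 < B by rewrite (lt_le_trans ltr01).
have l0 : 0 < l by rewrite divr_gt0// mulr_gt0// exprn_gt0.
have lB : l * B ^+ 2 = m / 4 by rewrite /l; field; rewrite gt_eqF.
have lf x : l * f x <= 2^-1.
  have : l * B <= 4^-1 by rewrite -(ler_pM2r B0) -mulrA -expr2 lB; lra.
  have := ler_norm (f x); have := fB x; nra.
have term x : p x * expR (l * f x) <=
    p x + l * (p x * f x) + 2 * l ^+ 2 * B ^+ 2 * p x.
  have h : f x ^+ 2 <= B ^+ 2.
    by rewrite -(real_normK (num_real (f x))) lerXn2r ?nnegrE// ltW.
  have h2 : expR (l * f x) <= 1 + l * f x + 2 * l ^+ 2 * B ^+ 2.
    apply: (le_trans (expR_le_quadratic (lf x))).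
    rewrite exprMn lerD2l mulrA ler_wpM2l//.
    by rewrite mulr_ge0// sqr_ge0.
  apply: (le_trans (ler_wpM2l (p0 x) h2)).
  by rewrite le_eqVlt; apply/orP; left; apply/eqP; ring.
exists (\sum_x p x * expR (l * f x)); split.
- by apply: sumr_ge0 => x _; rewrite mulr_ge0// expR_ge0.
- apply: (le_lt_trans (ler_sum _ (fun x _ => term x))).
  rewrite !big_split/= -!mulr_sumr p1 -[\sum_x _]opprK -/m mulr1.
  have -> : 2 * l ^+ 2 * B ^+ 2 = 2 * l * (l * B ^+ 2) by ring.
  rewrite lB; nra.
- move=> n; rewrite -sum_tuple_prod big_mkcond/=; apply: ler_sum => s _.
  rewrite big_split/= -expR_sum -mulr_sumr.
  have P0 : 0 <= \prod_(x <- s) p x by apply: prodr_ge0.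
  case: ifP => fs; last by rewrite mulr_ge0// expR_ge0.
  rewrite -[leLHS]mulr1 ler_wpM2l// -expR0 ler_expR.
  by apply: mulr_ge0 => //; exact: ltW.
Qed.

End Concentration.

Section EmpiricalDeviation.
Context {R : realType} {Y : finType} {M : nat}.
Variable nu : 'I_M -> {ffun Y -> R}.
Hypothesis nud : forall i, is_dist (nu i).

(** Some empirical distribution is not [dl]-close to the true one. *)
Definition deviates (dl : R) (s : seq (obs_vec M Y)) : bool :=
  [exists i, exists y, dl <= `|empirical R s i y - nu i y|].

(** The probability of such a deviation at time [n]. *)
Definition deviation_prob (dl : R) (n : nat) : R :=
  \sum_(s : n.-tuple (obs_vec M Y) | deviates dl s) prod_law nu s.

Lemma deviation_prob_ge0 dl n : 0 <= deviation_prob dl n.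
Proof.
by apply: sumr_ge0 => s _; apply: prod_law_ge0 => i y; case: (nud i).
Qed.

(** Apply [chernoff], for each sequence, letter and sign, to the deviation of the
    indicator of the letter from its mean, minus [dl]. *)
Lemma sum_deviation_prob (dl : R) : 0 < dl ->
  exists B, forall N, \sum_(n < N) deviation_prob dl n.+1 <= B.
Proof.
move=> dl0.
pose sg (b : bool) : R := if b then 1 else -1.
pose f (k : 'I_M * Y * bool) (x : obs_vec M Y) : R :=
  sg k.2 * ((x k.1.1 == k.1.2)%:R - nu k.1.1 k.1.2) - dl.
have P0 (x : obs_vec M Y) : 0 <= \prod_i nu i (x i).
  by apply: prodr_ge0 => i _; case: (nud i).
have nu1 i : \sum_y nu i y = 1 by case: (nud i).
have fneg k : \sum_(x : obs_vec M Y) (\prod_i nu i (x i)) * f k x < 0.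
  case: k => [[i y] b].
  rewrite (expect_coord i (fun z => sg b * ((z == y)%:R - nu i y) - dl) nu1).
  rewrite (_ : (\sum_z _) = - dl) ?oppr_lt0//.
  transitivity (sg b * (\sum_z nu i z * (z == y)%:R
      - nu i y * \sum_z nu i z) - dl * \sum_z nu i z).
    rewrite !mulr_sumr -!sumrB mulr_sumr -sumrB.
    by apply: eq_bigr => z _; ring.
  rewrite nu1 (bigD1 y)//= eqxx big1 ?addr0; last first.
    by move=> z /negbTE ->; rewrite mulr0.
  by rewrite /=; ring.
have [r rP] := choice (fun k => chernoff P0 (sum_obs_vec nu1) (fneg k)).
exists (\sum_k (1 - r k)^-1) => N.
apply: (@le_trans _ _ (\sum_(n < N) \sum_k r k ^+ n)); last first.
  rewrite exchange_big/=; apply: ler_sum => k _.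
  by have [r0 r1 _] := rP k; exact: geometric_sum_le.
apply: ler_sum => n _.
apply: (@le_trans _ _ (\sum_k r k ^+ n.+1)); last first.
  apply: ler_sum => k _; have [r0 r1 _] := rP k.
  by rewrite exprS ler_piMl ?exprn_ge0// ltW.
apply: (@le_trans _ _ (\sum_k \sum_(s : n.+1.-tuple (obs_vec M Y) |
    0 <= \sum_(x <- s) f k x) prod_law nu s)); last first.
  by apply: ler_sum => k _; have [_ _] := rP k; exact.
under [leRHS]eq_bigr do rewrite big_mkcond.
rewrite exchange_big/= /deviation_prob big_mkcond/=; apply: ler_sum => s _.
have Q0 : 0 <= prod_law nu s.
  by apply: prod_law_ge0 => i y; case: (nud i).
have T0 k : 0 <= if 0 <= \sum_(x <- s) f k x then prod_law nu s else 0.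
  by case: ifP.
case: ifP => [/existsP[i /existsP[y dev]]|_]; last by rewrite sumr_ge0.
pose b := 0 <= empirical R s i y - nu i y.
rewrite (bigD1 (i, y, b))//= ifT; first by rewrite lerDl sumr_ge0.
apply: (@le_trans _ _ ((size s)%:R *
    \sum_z empirical R s i z * (sg b * ((z == y)%:R - nu i y) - dl)));
  last by rewrite -sum_empirical.
rewrite mulr_ge0//.
have [_ e1] : is_dist (empirical R s i).
  by apply: empirical_dist; rewrite size_tuple.
rewrite (_ : (\sum_z _) = sg b * (empirical R s i y - nu i y) - dl).
  move: dev; rewrite /b subr_ge0; case: ger0P; rewrite /sg ?mul1r ?mulN1r//.
transitivity (sg b * (\sum_z empirical R s i z * (z == y)%:R
    - nu i y * \sum_z empirical R s i z) - dl * \sum_z empirical R s i z).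
  rewrite !mulr_sumr -!sumrB mulr_sumr -sumrB.
  by apply: eq_bigr => z _; ring.
rewrite e1 (bigD1 y)//= eqxx big1 ?addr0; last first.
  by move=> z /negbTE ->; rewrite mulr0.
by rewrite /=; ring.
Qed.

End EmpiricalDeviation.

(** * The exponent *)

Section ScatterContinuity.
Context {R : realType} {Y : finType} {M : nat}.
Variable nu : 'I_M -> {ffun Y -> R}.

(** The filter of coordinatewise convergence to [nu]. *)
Definition close_to : set_system ('I_M -> {ffun Y -> R}) :=
  filter_from [set e : R | 0 < e]
    (fun e => [set g : 'I_M -> {ffun Y -> R} | forall j y, `|g j y - nu j y| < e]).

Global Instance close_to_filter : Filter close_to.
Proof.
apply: filter_from_filter; first by exists 1 => /=.
move=> e1 e2 /= e10 e20; exists (Num.min e1 e2); first by rewrite /= lt_min e10.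
by move=> g /= H; split => j y; have := H j y; rewrite lt_min => /andP[].
Qed.

Lemma cvg_close_to j y : g j y @[g --> close_to] --> nu j y.
Proof.
apply/cvgrPdist_lt => e e0; exists e => //= g H.
by rewrite distrC; exact: H.
Qed.

Hypothesis nu_gt0 : forall j, full_support (nu j).

Lemma cvg_scatter (S : {set 'I_M}) :
  scatter g S @[g --> close_to] --> scatter nu S.
Proof.
apply: cvg_sum_real => j jS; apply: cvg_sum_real => y _.
have n0 i z : 0 <= nu i z by exact/ltW/nu_gt0.
have m0 : 0 < mean_off nu S y.
  exact: (abs_cont_mean_off n0 jS) (nu_gt0 j y).
apply: cvgM; first exact: cvg_close_to.
apply: continuous_cvg.
  by apply: continuous_ln; rewrite divr_gt0//; exact: nu_gt0.
apply: cvgM; first exact: cvg_close_to.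
apply: cvgV; first by rewrite gt_eqF.
rewrite [X in _ --> X]ffunE (_ : (fun g => mean_off g S y) =
    (fun g => (M - #|S|)%:R^-1 * \sum_(k | k \notin S) g k y)); last first.
  by apply/funext => g; rewrite ffunE.
apply: cvgM; first exact: cvg_cst.
by apply: cvg_sum_real => k _; exact: cvg_close_to.
Qed.

End ScatterContinuity.

Section Exponent.
Context {R : realType} {Y : finType} {M K : nat}.
Variables (mu : 'I_M -> {ffun Y -> R}) (pi : {ffun Y -> R}).
Hypothesis adm : admissible mu pi.
Hypotheses (K_gt0 : (0 < K)%N) (KM : (2 * K < M)%N).

Let c0 : (1 : R) <= (M - 2 * K)%:R.
Proof. by rewrite ler1n subn_gt0. Qed.

(** Positivity: no [p] is close to both [mu i] and [pi], so the objective is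
    bounded below by half of [hellinger (mu i) pi].
    Finiteness: take [p = pi]. *)
Lemma exponent_fin_gt0 (S : hypothesis M K) :
  exists2 a : R, 0 < a & exponent K mu pi (val S) = a%:E.
Proof.
have [dpi spi dmu smu mupi] := adm.
have [i0 i0S] : exists i0, i0 \in val S.
  by apply/card_gt0P; rewrite (eqP (valP S)).
suff /andP[lo hi] : (0 < exponent K mu pi (val S) < +oo)%E.
  exists (fine (exponent K mu pi (val S))).
    by rewrite fine_gt0// lo.
  by rewrite fineK// gt0_fin_numE.
apply/andP; split.
  apply/bigmin_gtP; split => // i iS.
  apply: (@lt_le_trans _ _ (2^-1 * hellinger (mu i) pi)%:E).
    by rewrite lte_fin mulr_gt0// hellinger_gt0.
  apply/ereal_infP => _ /= [p dp <-].
  apply: (@le_trans _ _ ((hellinger (mu i) p)%:E + (hellinger pi p)%:E)%E).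
    by rewrite -EFinD lee_fin ler_pdivrMl// hellinger_triangle.
  rewrite leeD ?hellinger_le_KL//.
  apply: (le_trans (hellinger_le_KL dpi dp)).
  by rewrite lee_pemull ?lee_fin// KL_ge0.
apply: (le_lt_trans (bigmin_le_cond _ _ i0S)).
apply: (@le_lt_trans _ _
    (KL (mu i0) pi + (M - 2 * K)%:R%:E * KL pi pi)%E).
  by apply: ereal_inf_lbound; exists pi.
have ge0 p : is_dist p -> forall y, 0 <= p y by case.
rewrite !KL_rel_ent//; [|exact: ge0|exact: ge0].
by rewrite -EFinM -EFinD ltry.
Qed.

Lemma scatter_truth (S : {set 'I_M}) : scatter (seq_law mu pi S) S = 0.
Proof.
have [[pi0 _] spi _ _ _] := adm.
rewrite /scatter big1// => j jS.
suff -> : mean_off (seq_law mu pi S) S = pi.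
  by rewrite /seq_law (negbTE jS) rel_ent_refl.
apply/ffunP => y; rewrite ffunE (eq_bigr (fun=> pi y)); last first.
  by move=> k /negbTE kS; rewrite /seq_law kS.
rewrite sumr_const card_notin -[pi y *+ _]mulr_natl mulrA mulVf ?mul1r//.
by rewrite pnatr_eq0 -lt0n subn_gt0 (card_lt_notin jS).
Qed.

(** A wrong guess [S'] leaves outside of it some outlier, together with at least
    [M - 2 * K] typical sequences. *)
Lemma exponent_le_scatter (S S' : hypothesis M K) : S' != S ->
  (exponent K mu pi (val S) <= (scatter (seq_law mu pi (val S)) (val S'))%:E)%E.
Proof.
move=> S'S; have [dpi spi dmu smu mupi] := adm.
have cS : #|val S| = K by apply/eqP; exact: valP S.
have cS' : #|val S'| = K by apply/eqP; exact: valP S'.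
have [i iS iS'] : exists2 i, i \in val S & i \notin val S'.
  apply/subsetPn; apply: contra S'S => SS'.
  by rewrite -val_eqE eq_sym/= eqEcard SS' cS cS' leqnn.
set nu := seq_law mu pi (val S); set m := mean_off nu (val S').
have nud j : is_dist (nu j) by exact: seq_law_dist.
have nu0 j y : 0 <= nu j y by case: (nud j).
have dm : is_dist m by exact: mean_off_dist iS' nud.
have ac j : j \notin val S' -> abs_cont (nu j) m.
  by move=> jS'; exact: abs_cont_mean_off.
have nui : nu i = mu i by rewrite /nu /seq_law iS.
apply: (le_trans (bigmin_le_cond _ _ iS)).
apply: (@le_trans _ _ (KL (mu i) m + (M - 2 * K)%:R%:E * KL pi m)%E).
  by apply: ereal_inf_lbound; exists m.
have cC : (M - 2 * K <= #|~: (val S' :|: val S)|)%N.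
  rewrite cardsCs finset.setCK card_ord leq_sub2l//.
  by rewrite mul2n -addnn (leq_trans (leq_card_setU _ _))// cS cS'.
have [k] : exists k, k \in ~: (val S' :|: val S).
  by apply/card_gt0P; rewrite (leq_trans _ cC)// subn_gt0.
rewrite !inE negb_or => /andP[kS' kS].
have pim : abs_cont pi m by have := ac _ kS'; rewrite /nu /seq_law (negbTE kS).
have m0 : 0 <= rel_ent pi m by exact: rel_ent_ge0.
rewrite !KL_rel_ent//; [|by case: dpi|by case: (dmu i)|by rewrite -nui; exact: ac].
rewrite -EFinM -EFinD lee_fin /scatter -/nu -/m (bigID (mem (val S)))/=.
apply: lerD.
  rewrite (bigD1 i) ?iS'//= nui lerDl sumr_ge0// => j /andP[/andP[jS' _] _].
  by apply: rel_ent_ge0 => //; exact: ac.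
rewrite (eq_bigr (fun=> rel_ent pi m)); last first.
  by move=> j /andP[_ /negbTE jS]; rewrite /nu /seq_law jS.
rewrite sumr_const -[leRHS]mulr_natl ler_wpM2r// ler_nat (leq_trans cC)//.
by apply/subset_leq_card/fintype.subsetP => j; rewrite !inE negb_or.
Qed.

(** For distributions close enough to the true ones, every wrong guess exceeds the
    true set by more than a given rate below the exponent. *)
Lemma scatter_separation (S : hypothesis M K) (a : R) :
  (a%:E < exponent K mu pi (val S))%E ->
  exists2 dl : R, 0 < dl & forall g : 'I_M -> {ffun Y -> R},
    (forall j y, `|g j y - seq_law mu pi (val S) j y| < dl) ->
    forall S' : hypothesis M K, S' != S ->
    a < scatter g (val S') - scatter g (val S).
Proof.
move=> a_lt; set nu := seq_law mu pi (val S).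
have nu0 j : full_support (nu j) by exact: seq_law_supp.
suff [dl /= dl0 H] : \forall g \near close_to nu, forall S' : hypothesis M K,
    S' != S -> a < scatter g (val S') - scatter g (val S).
  by exists dl => // g gnu; exact: H.
apply: filter_forall => S'; have [->|S'S] := eqVneq S' S.
  exact: filterE.
have lim : scatter g (val S') - scatter g (val S) @[g --> close_to nu]
    --> scatter nu (val S') - scatter nu (val S).
  by apply: cvgB; exact: cvg_scatter.
have : a < scatter nu (val S') - scatter nu (val S).
  rewrite [scatter nu (val S)]scatter_truth subr0 -lte_fin.
  exact: lt_le_trans a_lt (exponent_le_scatter S'S).
by move/(cvgr_gt _ lim); apply: filterS.
Qed.

End Exponent.

(** * Stopping time and error probability *)

Section StoppingTime.
Context {R : realType} {Y : finType} {M K : nat}.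
Hypotheses (K_gt0 : (0 < K)%N) (KM : (2 * K < M)%N).
Variables (mu : 'I_M -> {ffun Y -> R}) (pi : {ffun Y -> R}).
Hypothesis adm : admissible mu pi.

(** When the empirical distributions are close to the true ones, the minimizer is
    the true set [S] and every other guess exceeds it by more than [a]. *)
Lemma stops_if_close (S : hypothesis M K) (a : R) :
  0 < a -> (a%:E < exponent K mu pi (val S))%E ->
  exists2 dl : R, 0 < dl &
    forall Shat : seq (obs_vec M Y) -> hypothesis M K, is_argmin R Shat ->
    forall (T : R) s, (0 < size s)%N ->
      ~~ deviates (seq_law mu pi (val S)) dl s ->
      ln T + (M.+1 * #|Y|)%:R * ln (size s).+1%:R < (size s)%:R * a ->
      stops (outlier_test Shat T) s.
Proof.
move=> a0 aexp; have [dl dl0 sep] := scatter_separation adm KM aexp.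
exists dl => // Shat amin T s s0 ndev thr.
have {}sep : forall S' : hypothesis M K, S' != S ->
    a < scatter (empirical R s) (val S') - scatter (empirical R s) (val S).
  apply: sep => j y; rewrite ltNge; apply: contra ndev => dev.
  by apply/existsP; exists j; apply/existsP; exists y.
have ShatS : Shat s = S.
  apply/eqP; apply: contraT => /sep h.
  have := amin s S; rewrite !G_scatter lee_fin => h2.
  by have := lt_trans a0 h; rewrite subr_gt0 ltNge h2.
rewrite /= s0/=; apply/bigmin_gtP; split; first exact: ltry.
move=> S'; rewrite ShatS => /sep h.
rewrite !G_scatter -EFinB -EFinM lte_fin (lt_le_trans thr)//.
by rewrite ler_wpM2l// ltW.
Qed.

(** Past a time of order [ln T / a'], the test stops as soon as the empirical
    distributions are close to the true ones. *)
Lemma stops_after (S : hypothesis M K) (a' : R) :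
  0 < a' -> (a'%:E < exponent K mu pi (val S))%E ->
  exists2 dl : R, 0 < dl & exists2 B : R, 0 <= B &
    forall Shat : seq (obs_vec M Y) -> hypothesis M K, is_argmin R Shat ->
    forall T : R, 0 < T -> exists nT : nat,
      [/\ (0 < nT)%N, nT%:R <= Num.max (ln T) 0 / a' + B &
      forall s, (nT <= size s)%N ->
        ~~ deviates (seq_law mu pi (val S)) dl s ->
        stops (outlier_test Shat T) s].
Proof.
move=> a'0; have [al al0 expE] := exponent_fin_gt0 adm K_gt0 KM S.
rewrite expE lte_fin => a'al.
(* The room between [a'] and [a] pays for the logarithmic term of the threshold. *)
pose a := (a' + al) / 2.
have a'a : a' < a by rewrite /a; lra.
have aal : a < al by rewrite /a; lra.
have [] := @stops_if_close S a (lt_trans a'0 a'a); first by rewrite expE lte_fin.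
move=> dl dl0 close; exists dl => //.
have [n0 n00 n0P] := @ln_le_linear R (M.+1 * #|Y|)%:R (a - a')
  (ler0n _ _) ltac:(by rewrite subr_gt0).
exists n0.+1%:R => // Shat amin T T0.
have m0 : 0 <= Num.max (ln T) 0 / a'.
  by rewrite divr_ge0 ?(ltW a'0)// le_max lexx orbT.
exists (n0 + (Num.truncn (Num.max (ln T) 0 / a')%R).+1)%N; split.
- by rewrite addnS.
- by rewrite addnS -addSn natrD addrC lerD2r truncn_le.
- move=> s ns ndev; apply: (close _ amin) => //.
    by apply: leq_trans ns; rewrite addnS.
  have h1 := n0P _ (leq_trans (leq_addr _ _) ns).
  suff h2 : ln T < (size s)%:R * a' by nra.
  apply: (@le_lt_trans _ _ (Num.max (ln T) 0)); first by rewrite le_max lexx.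
  rewrite -ltr_pdivrMr// (lt_le_trans (truncnS_gt _))// ler_nat.
  exact: leq_trans (leq_addl _ _) ns.
Qed.

Section Performance.
Variable S : hypothesis M K.
Variable a' : R.
Hypotheses (a'_gt0 : 0 < a') (a'_lt : (a'%:E < exponent K mu pi (val S))%E).

(** The test runs up to time [nT], and afterwards only as long as the empirical
    distributions deviate from the true ones, which costs a bounded expected time. *)
Lemma expected_time_le : exists2 B : R, 0 <= B &
  forall Shat : seq (obs_vec M Y) -> hypothesis M K, is_argmin R Shat ->
  forall d (Omega : measurableType d) (X : outlier_model K mu pi Omega) (T : R),
  0 < T ->
  (expected_time X (outlier_test Shat T) S <=
     (Num.max (ln T) 0 / a' + B)%:E)%E.
Proof.
have [dl dl0 [B1 B10 H]] := stops_after a'_gt0 a'_lt.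
have nud := @seq_law_dist R Y M mu pi adm (val S).
have [B2 B2P] := sum_deviation_prob nud dl0.
have B20 : 0 <= B2 by have := B2P 0%N; rewrite big_ord0.
exists (B1 + B2); first exact: addr_ge0.
move=> Shat amin d Omega X T T0.
have [nT [nT0 nTle st]] := H _ amin T T0.
set t := outlier_test Shat T.
pose E k : set Omega :=
  hist_event X k (fun s => (k < nT)%N || deviates (seq_law mu pi (val S)) dl s).
have mE k : measurable (E k) by exact: measurable_hist_event.
have ind0 k w : (0 <= (\1_(E k) w)%:E :> \bar R)%E.
  by rewrite lee_fin indicE.
have st0 w : (0 <= stopping_time X t w)%E.
  by apply/ereal_infP => _ /= [n _ <-]; rewrite lee_fin.
have partial n w : (forall k, (k < n)%N -> E k w) ->
    (n%:R%:E <= \sum_(0 <= k <oo) (\1_(E k) w)%:E :> \bar R)%E.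
  move=> En; apply: le_trans (nneseries_lim_ge n _) => //.
  rewrite sumEFin lee_fin big_mkord (eq_bigr (fun=> 1)).
    by rewrite sumr_const card_ord.
  by move=> k _; rewrite indicE mem_set//; exact: En.
(* The stopping time is at most the first [m] outside [E m], hence at most the
   number of indices [k] with [E k]. *)
have dom w : (stopping_time X t w <= \sum_(0 <= k <oo) (\1_(E k) w)%:E)%E.
  have [[m nEm]|allE] := pselect (exists m, ~ E m w); last first.
    rewrite (_ : (\sum_(_ <= _ <oo) _)%E = +oo%E) ?leey//.
    apply/eqyP => A A0; apply: le_trans (partial (Num.bound A) w _).
      by rewrite lee_fin ltW// archi_boundP// ltW.
    by move=> k _; apply: contrapT => nE; apply: allE; exists k.
  have [m' /asboolPn nEm' minm] := ex_minnP (ex_intro (fun m => ~~ `[< E m w >]) m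
    ltac:(by apply/asboolPn)).
  apply: le_trans (partial m' w _); last first.
    by move=> k km; apply: contrapT => /asboolPn /minm; rewrite leqNgt km.
  apply: ereal_inf_lbound; exists m' => //=.
  move: nEm'; rewrite /E /hist_event/= => /negP.
  rewrite negb_or -leqNgt => /andP[h1 h2].
  by apply: st => //; rewrite size_hist.
apply: (le_trans (ge0_integral_mono (Pr X S) st0 dom)).
rewrite integral_nneseries//; last first.
  move=> k; apply/measurable_realfun.measurable_EFinP.
  exact: measurable_realfun.measurable_indic.
under eq_eseriesr do rewrite integral_indic// setIT.
apply: lime_le; first exact: is_cvg_nneseries.
apply: nearW => N.
apply: (@le_trans _ _ (\sum_(k < N) ((k < nT)%N%:R +
    (0 < k)%N%:R * deviation_prob (seq_law mu pi (val S)) dl k)%:E)%E).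
  rewrite big_mkord; apply: lee_sum => k _; rewrite /E.
  have [kn|nk] /= := ltnP k nT.
    rewrite (le_trans (probability_le1 _ _))//; first exact: measurable_hist_event.
    by rewrite lee_fin lerDl mulr_ge0// deviation_prob_ge0.
  by rewrite Pr_hist_event lee_fin add0r (leq_trans nT0 nk) mul1r.
rewrite sumEFin lee_fin big_split/= addrA lerD//.
  apply: le_trans nTle; rewrite -natr_sum ler_nat.
  have -> : (\sum_(k < N) (k < nT)%N = minn N nT)%N.
    elim: N => [|N IH]; first by rewrite big_ord0 min0n.
    rewrite big_ord_recr/= IH; lia.
  exact: geq_minr.
apply: le_trans (B2P N); case: N => [|N]; first by rewrite !big_ord0.
rewrite big_ord_recl/= mul0r add0r big_ord_recr/= ler_wpDr ?deviation_prob_ge0//.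
by apply: ler_sum => k _; rewrite mul1r.
Qed.

End Performance.

Lemma measurable_error_event d (Omega : measurableType d)
    (X : outlier_model K mu pi Omega) (t : seq_test Y M K) (S : hypothesis M K) :
  measurable (error_event X t S).
Proof.
pose A n s := [&& stops t s, all (fun m => ~~ stops t (take m s)) (iota 0 n)
  & decision t s == S].
rewrite (_ : error_event X t S = ~` \bigcup_n hist_event X n (A n)).
  apply: measurableC; apply: bigcupT_measurable => n.
  exact: measurable_hist_event.
congr (~` _); apply/seteqP; split => w /=.
  move=> [n [[sn mn] dn]]; exists n => //.
  rewrite /hist_event/= /A sn/= dn eqxx andbT.
  apply/allP => k; rewrite mem_iota add0n => /andP[_ kn].
  by rewrite /hist /mkseq -map_take take_iota (minn_idPl (ltnW kn)); exact: mn.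
move=> [n _ /and3P[sn /allP mn /eqP dn]]; exists n; split => //; split => // k kn.
have := mn k; rewrite mem_iota add0n kn => /(_ isT).
by rewrite /hist /mkseq -map_take take_iota (minn_idPl (ltnW kn)).
Qed.

(** The test stops almost surely, and the probabilities of a wrong decision at
    the successive times add up to at most [T^-1]. *)
Lemma Pr_error_le (S : hypothesis M K) (Shat : seq (obs_vec M Y) -> hypothesis M K)
    d (Omega : measurableType d) (X : outlier_model K mu pi Omega) (T : R) :
  is_argmin R Shat -> 0 < T ->
  (Pr X S (error_event X (outlier_test Shat T) S) <= T^-1%:E)%E.
Proof.
move=> amin T0; set t := outlier_test Shat T.
have [al al0 expE] := exponent_fin_gt0 adm K_gt0 KM S.
have [|dl dl0 [B1 B10 H]] := @stops_after S (al / 2) (divr_gt0 al0 (ltr0n _ 2)).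
  by rewrite expE lte_fin; lra.
have [nT [nT0 _ st]] := H _ amin T T0.
have nud := @seq_law_dist R Y M mu pi adm (val S).
have [B2 B2P] := sum_deviation_prob nud dl0.
have Y2 : (1 < #|Y|)%N.
  have M0 : (0 < M)%N by apply: leq_trans KM.
  case: adm => dpi _ dmu _ /(_ (Ordinal M0)); exact: dist_neq_card.
pose W n : set Omega := hist_event X n (fun s => stops t s && (Shat s != S)).
pose D m : set Omega := hist_event X m (deviates (seq_law mu pi (val S)) dl).
have sub m : (nT <= m)%N ->
    error_event X t S `<=` (\big[setU/set0]_(n < m) W n.+1) `|` D m.
  move=> nm w err; have [dev|/negP ndev] := pselect (D m w); [by right|left].
  have stm : stops t (hist X m w) by apply: st => //; rewrite size_hist.
  have [n stn minn] := ex_minnP (ex_intro (fun n => stops t (hist X n w)) m stm).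
  have n0 : (0 < n)%N.
    by move: stn => /andP[]; rewrite size_hist.
  have nm' : (n.-1 < m)%N by rewrite prednK// minn.
  rewrite (bigD1 (Ordinal nm'))//=; left; rewrite /= (prednK n0).
  apply/andP; split=> //; apply/eqP => ShS; apply: err; exists n.
  split => //; split => //.
  by move=> k kn; apply/negP => /minn; rewrite leqNgt kn.
have mW n : measurable (W n) by exact: measurable_hist_event.
have mD n : measurable (D n) by exact: measurable_hist_event.
have mU m : measurable (\big[setU/set0]_(n < m) W n.+1).
  by apply: bigsetU_measurable.
have merr := measurable_error_event X t S.
(* [(n + 2)^-|Y| <= (n + 1)^-1 - (n + 2)^-1] because [|Y| >= 2], and the sum
   telescopes. *)
have PW m : (Pr X S (\big[setU/set0]_(n < m) W n.+1) <= T^-1%:E)%E.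
  apply: (@le_trans _ _ (\sum_(n < m) Pr X S (W n.+1))%E).
    by apply: (@Boole_inequality _ _ _ _ (fun n => W n.+1)).
  apply: (@le_trans _ _ (\sum_(n < m) (T^-1 * (n.+1%:R^-1 - n.+2%:R^-1))%:E)%E).
    apply: lee_sum => n _; apply: (le_trans (Pr_wrong_stop X adm Shat S T0 _)) => //.
    rewrite lee_fin ler_wpM2l ?invr_ge0 ?(ltW T0)//.
    have n1 : (0 : R) < n.+1%:R by rewrite ltr0n.
    have n2 : (0 : R) < n.+2%:R by rewrite ltr0n.
    apply: (@le_trans _ _ (n.+2%:R ^+ 2)^-1).
      rewrite lef_pV2 ?posrE ?exprn_gt0//.
      by rewrite ler_eXn2l// ltr1n.
    have -> : (n.+1%:R^-1 - n.+2%:R^-1 : R) = (n.+1%:R * n.+2%:R)^-1.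
      move: n1 n2; rewrite -[n.+2%:R]natr1; move: n.+1%:R => x x0 x1.
      by field; rewrite !gt_eqF.
    by rewrite lef_pV2 ?posrE ?exprn_gt0 ?mulr_gt0// expr2 ler_pM2r// ler_nat.
  rewrite sumEFin lee_fin -mulr_sumr.
  rewrite -[leRHS]mulr1 ler_wpM2l ?invr_ge0 ?(ltW T0)//.
  rewrite -(big_mkord xpredT (fun n => n.+1%:R^-1 - n.+2%:R^-1 : R)).
  have -> : \sum_(0 <= n < m) (n.+1%:R^-1 - n.+2%:R^-1 : R) = 1 - m.+1%:R^-1.
    rewrite -[LHS]opprK -sumrN.
    under eq_bigr do rewrite opprB.
    by rewrite (telescope_sumr (fun n => n.+1%:R^-1 : R))// opprB invr1.
  by rewrite gerBl invr_ge0.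
(* The probability of deviation at time [m] has a bounded sum over [m], so it is
   small for some [m]. *)
apply/lee_addgt0Pr => e e0.
suff [m nm De] : exists2 m, (nT <= m)%N &
    deviation_prob (seq_law mu pi (val S)) dl m <= e.
  apply: (@le_trans _ _ (Pr X S ((\big[setU/set0]_(n < m) W n.+1) `|` D m))).
    by apply: le_measure; rewrite ?inE//; [exact: measurableU|exact: sub].
  apply: (le_trans (measureU2 _ (mU m) (mD m))).
  apply: leeD; first exact: PW.
  suff h : (Pr X S (D m) <= e%:E)%E by exact: h.
  by rewrite /D Pr_hist_event lee_fin.
apply: contrapT => nex.
have dev_gt m : (nT <= m)%N -> e < deviation_prob (seq_law mu pi (val S)) dl m.
  by move=> nm; rewrite ltNge; apply/negP => De; apply: nex; exists m.
have B20 : 0 <= B2 by have := B2P 0%N; rewrite big_ord0.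
pose k := Num.bound (B2 / e).
have kB : B2 / e < k%:R by apply: archi_boundP; rewrite divr_ge0// ltW.
have := B2P (nT + k)%N; rewrite leNgt => /negP; apply.
rewrite big_split_ord/= ltr_wpDl//.
  by apply: sumr_ge0 => i _; exact: deviation_prob_ge0.
rewrite ltr_pdivrMr// in kB; apply: (lt_le_trans kB).
rewrite -[k in k%:R]card_ord mulr_natl -sumr_const; apply: ler_sum => i _.
by apply/ltW/dev_gt; rewrite leqW// leq_addr.
Qed.

End StoppingTime.

(** * Asymptotics *)

Section Conclusion.
Context {R : realType} {Y : finType} {M K : nat}.
Hypotheses (K_gt0 : (0 < K)%N) (KM : (2 * K < M)%N).
Variables (mu : 'I_M -> {ffun Y -> R}) (pi : {ffun Y -> R}).
Hypothesis adm : admissible mu pi.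
Variable Shat : seq (obs_vec M Y) -> hypothesis M K.
Hypothesis amin : is_argmin R Shat.
Variables (d : measure_display) (Omega : measurableType d).
Variable X : outlier_model K mu pi Omega.

Local Notation PM T := (Pmax X (outlier_test Shat T)).
Local Notation ET T S := (expected_time X (outlier_test Shat T) S).

Lemma Pmax_le (T : R) : 0 < T -> (PM T <= T^-1%:E)%E.
Proof.
by move=> T0; apply: bigmax_le => [|S _]; [rewrite leNye|exact: Pr_error_le].
Qed.

Lemma Pmax_ge0 (T : R) : (0 <= PM T)%E.
Proof.
exact: le_trans (measure_ge0 (Pr X (Shat [::])) _)
  (le_bigmax _ (fun S => Pr X S (error_event X _ S)) (Shat [::])).
Qed.

Lemma Pmax_le1 (T : R) : (PM T <= 1)%E.
Proof.
apply: bigmax_le => [|S _]; first by rewrite leNye.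
by apply: probability_le1; exact: measurable_error_event.
Qed.

(** [- lne Pmax] is [+oo] or a real number that is at least [ln T] and 0. *)
Lemma neg_ln_Pmax (T : R) : 0 < T ->
  (- lne (PM T) = +oo)%E \/
  exists2 L : R, (- lne (PM T) = L%:E)%E & Num.max (ln T) 0 <= L.
Proof.
move=> T0; have := Pmax_ge0 T; have := Pmax_le T0; have := Pmax_le1 T.
case: (PM T) => [p||]//; rewrite !lee_fin => p1 pT.
rewrite le_eqVlt => /predU1P[<-|p0]; first by left; rewrite /= lexx.
right; exists (- ln p); first by rewrite lne_EFin.
rewrite ge_max oppr_ge0 ln_le0// andbT lerNr -lnV// ?posrE//.
by rewrite ler_ln ?posrE ?invr_gt0.
Qed.

Lemma expected_time_ge0 (T : R) S : (0 <= ET T S)%E.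
Proof.
apply: integral_ge0 => w _; apply/ereal_infP => _ /= [n _ <-].
by rewrite lee_fin.
Qed.

Lemma Pmax_cvg0 : PM T @[T --> pinfty_nbhs R] --> 0%E.
Proof.
apply: (@squeeze_cvge _ (pinfty_nbhs R) _ R (fun=> 0%E) (fun T => PM T)
  (fun T : R => T^-1%:E)).
- near=> T; rewrite Pmax_ge0 Pmax_le//.
- exact: cvg_cst.
- apply: cvg_EFin; first exact: nearW.
  by apply/(gtr0_cvgV0 (f := id)); [exact: nbhs_pinfty_gt|exact: cvg_id].
Unshelve. all: by end_near. Qed.

(** With a rate below the exponent, the additive constant of [expected_time_le] is
    absorbed once [Pmax] is small, whatever [T] is. *)
Lemma expected_time_vanishing (S : hypothesis M K) : exists2 alpha : R, 0 < alpha &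
  asymp_le (vanishing (fun T => PM T)) (fun T => ET T S)
    (fun T => - lne (PM T) / alpha%:E)%E.
Proof.
have [al al0 expE] := exponent_fin_gt0 adm K_gt0 KM S.
have [|B B0 HB] := @expected_time_le R Y M K K_gt0 KM mu pi adm S (al / 2)
    (divr_gt0 al0 (ltr0n _ 2)).
  by rewrite expE lte_fin; lra.
exists (al / 4); first by rewrite divr_gt0.
exists (fun=> 0); split.
  by move=> A A0; exists 1 => //= T _; exact: nbhs_singleton A0.
exists (expR (- (B * al / 2))) => /=; first exact: expR_gt0.
move=> T /= [T0 PT].
apply: (le_trans (HB _ amin _ _ X _ T0)).
rewrite addr0 mule1 inver gt_eqF ?divr_gt0//.
case: (neg_ln_Pmax T0) => [->|[L LE Lge]].
  by rewrite gt0_mulye ?leey// lte_fin invr_gt0 divr_gt0.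
rewrite LE -EFinM lee_fin.
have LB : B * al / 2 <= L.
  rewrite -lee_fin -LE.
  have := Pmax_ge0 T; case: (PM T) PT LE => [p||]//.
  rewrite lte_fin lee_fin => pe LE; rewrite le_eqVlt => /predU1P[p0|p0].
    by move: LE; rewrite -p0 /= lexx.
  rewrite lne_EFin// lee_fin lerNr -[leRHS]expRK ler_ln ?posrE ?expR_gt0//.
  exact: ltW.
have -> : L / (al / 4) = L / (al / 2) + L / (al / 2).
  by field; rewrite gt_eqF.
apply: lerD; first by rewrite ler_wpM2r// invr_ge0 divr_ge0// ltW.
by rewrite ler_pdivlMr ?divr_gt0// mulrA.
Qed.

Lemma expected_time_asymp (S : hypothesis M K) :
  asymp_le (pinfty_nbhs R) (fun T => ET T S)
    (fun T => - lne (PM T) / exponent K mu pi (val S))%E.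
Proof.
have [al al0 expE] := exponent_fin_gt0 adm K_gt0 KM S.
(* The smallest non-negative correction for which the bound holds with [ln T] in
   place of [- lne Pmax]. *)
exists (fun T => Num.max 0 (al * fine (ET T S) / ln T - 1)); split.
  apply/cvgrPdist_le => e e0.
  (* Half of the tolerance [e] goes to the rate and half to the constant [B]. *)
  pose a' := al / (1 + e / 2).
  have e1 : 0 < 1 + e / 2 by lra.
  have a'0 : 0 < a' by rewrite divr_gt0.
  have [|B B0 HB] := @expected_time_le R Y M K K_gt0 KM mu pi adm S a' a'0.
    by rewrite expE lte_fin /a' ltr_pdivrMr// ltr_pMr//; lra.
  near=> T.
  have T1 : 1 < T by near: T; exact: nbhs_pinfty_gt.
  have T0 : 0 < T by exact: lt_trans T1.
  have lnT : 0 < ln T by rewrite ln_gt0.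
  have lnTB : 2 * al * B / e <= ln T.
    have : expR (2 * al * B / e) <= T by near: T; exact: nbhs_pinfty_ge.
    by move=> h; rewrite -[leLHS]expRK ler_ln ?posrE ?expR_gt0.
  rewrite sub0r normrN ger0_norm ?le_max ?lexx// ge_max (ltW e0)/=.
  rewrite lerBlDr ler_pdivrMr//.
  have := HB _ amin _ _ X _ T0; rewrite (max_idPl (ltW lnT)).
  have := expected_time_ge0 T S; case: (ET T S) => [E||]// _; rewrite lee_fin => h.
  have {h} : al * E <= al * (ln T / a' + B) by rewrite ler_wpM2l// ltW.
  have -> : al * (ln T / a' + B) = (1 + e / 2) * ln T + al * B.
    rewrite /a'; move: (1 + e / 2) e1 => c c0; field; rewrite !gt_eqF//.
  move/le_trans; apply.
  rewrite ler_pdivrMr// in lnTB; nra.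
have [|B B0 HB] := @expected_time_le R Y M K K_gt0 KM mu pi adm S (al / 2)
    (divr_gt0 al0 (ltr0n _ 2)).
  by rewrite expE lte_fin; lra.
near=> T.
have T1 : 1 < T by near: T; exact: nbhs_pinfty_gt.
have T0 : 0 < T by exact: lt_trans T1.
have lnT : 0 < ln T by rewrite ln_gt0.
set o := Num.max 0 _.
have o0 : 0 <= o by rewrite le_max lexx.
have o1 : 0 < 1 + o by lra.
rewrite expE inver gt_eqF//.
case: (neg_ln_Pmax T0) => [->|[L -> Lge]].
  by rewrite gt0_mulye ?lte_fin ?invr_gt0// gt0_mulye ?lte_fin// leey.
have oge : al * fine (ET T S) / ln T - 1 <= o by rewrite le_max lexx orbT.
move: oge; have := HB _ amin _ _ X _ T0; have := expected_time_ge0 T S.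
case: (ET T S) => [E||]//= _ _; rewrite lerBlDl ler_pdivrMr// => oge.
rewrite -!EFinM lee_fin mulrAC ler_pdivlMr// mulrC.
apply: (le_trans oge); rewrite mulrC ler_wpM2r// ?(ltW o1)//.
by move: Lge; rewrite ge_max => /andP[].
Unshelve. all: by end_near. Qed.

End Conclusion.

Local Open Scope ereal_scope.

Theorem theorem5 (R : realType) (Y : finType) (M K : nat)
    (hM : (3 <= M)%N) (hK2 : (2 < K)%N) (hKM : (2 * K < M)%N) :
  (forall Shat : seq (obs_vec M Y) -> hypothesis M K, is_argmin R Shat ->
     universally_exponentially_consistent
       (fun T : R => outlier_test Shat T)) /\
  (forall (mu : 'I_M -> {ffun Y -> R}) (pi : {ffun Y -> R}),
     admissible mu pi ->
     (exists C : R,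
        forall Shat : seq (obs_vec M Y) -> hypothesis M K, is_argmin R Shat ->
        forall (d : measure_display) (Omega : measurableType d)
          (X : outlier_model K mu pi Omega) (T : R),
        (0 < T)%R -> Pmax X (outlier_test Shat T) <= (C / T)%R%:E) /\
     (forall Shat : seq (obs_vec M Y) -> hypothesis M K, is_argmin R Shat ->
        forall (d : measure_display) (Omega : measurableType d)
          (X : outlier_model K mu pi Omega) (S : hypothesis M K),
        asymp_le (pinfty_nbhs R)
          (fun T => expected_time X (outlier_test Shat T) S)
          (fun T => - lne (Pmax X (outlier_test Shat T))
                    / exponent K mu pi (val S)))).
Proof.
have K0 : (0 < K)%N by exact: leq_trans hK2.
split => [Shat amin mu pi adm d Omega X|mu pi adm].
  split; first exact: Pmax_cvg0.
  by move=> S; exact: expected_time_vanishing.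
split; last by move=> Shat amin d Omega X S; exact: expected_time_asymp.
exists 1%R => Shat amin d Omega X T T0.
by rewrite div1r; exact: Pmax_le.
Qed.
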